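(* Let $L\in(0,\infty)$, $\mu\in(-\infty,L)$, and let $f\in\mathcal{F}_{\mu,L}(\mathbb{R}^n)$ have a non-empty set of global minimizers $X^\star$. If $f$ has a quadratic gradient growth on $X\subseteq\mathbb{R}^n$ with constant $\mu_g>0$, then $f$ satisfies the Polyak-Łojasiewicz inequality on $X$ with constant $\mu_p=\tfrac{\mu_g^2}{L}$.
   Context: $\|\cdot\|$, $\langle\cdot,\cdot\rangle$ are the Euclidean norm and inner product, $f^\star=\inf_{x\in\mathbb{R}^n}f(x)$. $\mathcal{F}_{\mu,L}(\mathbb{R}^n)$ denotes the set of differentiable functions $f:\mathbb{R}^n\to\mathbb{R}$ such that both $\tfrac{L}{2}\|\cdot\|^2-f$ and $f-\tfrac{\mu}{2}\|\cdot\|^2$ are convex. $d_{X^\star}(x)=\inf_{y\in X^\star}\|y-x\|$ and $\Pi_{X^\star}(x)=\{y\in X^\star:\|y-x\|=d_{X^\star}(x)\}$. Quadratic gradient growth on $X$ with constant $\mu_g>0$: for every $x\in X$, $\langle\nabla f(x),x-x^\star\rangle\ge\mu_g\, d_{X^\star}^2(x)$ for some $x^\star\in\Pi_{X^\star}(x)$. Polyak-Łojasiewicz (PŁ) inequality on $X$ with constant $\mu_p>0$: $f(x)-f^\star\le\tfrac{1}{2\mu_p}\|\nabla f(x)\|^2$ for all $x\in X$. *)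

(* Defs.v *)
(* R^n is the type 'rV[R]_n of row vectors. *)
From mathcomp Require Export all_boot all_order all_algebra.
From mathcomp Require Export boolp classical_sets reals.
From mathcomp Require Export topology normedtype derive convex.

Set Implicit Arguments.
Unset Strict Implicit.
Unset Printing Implicit Defensive.

Import Order.TTheory GRing.Theory Num.Theory.
Export numFieldNormedType.Exports.

Local Open Scope classical_set_scope.
Local Open Scope ring_scope.

Section definitions.
Context {R : realType} {n : nat}.
Implicit Types (u v x y : 'rV[R]_n) (S X : set 'rV[R]_n) (f : 'rV[R]_n -> R).

Definition dot u v : R := \sum_(i < n) u 0 i * v 0 i.

(* The library norm `|u| on 'rV[R]_n is the sup norm. It defines the same
   topology, and [differentiable] below, which is built on it, is the usual
   (Frechet) notion; every metric quantity uses [enorm] instead. *)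
Definition enorm u : R := Num.sqrt (dot u u).

(* Vector of partial derivatives; only used for differentiable f. *)
Definition gradient f x : 'rV[R]_n := \row_(i < n) 'D_(delta_mx 0 i) f x.

(* The class F_{mu,L}(R^n); mu may be negative. *)
Definition curvature_class (mu L : R) f : Prop :=
  [/\ forall x, differentiable f x,
      @convex_function R 'rV[R]_n [set: 'rV[R]_n]
        (fun x => L / 2 * enorm x ^+ 2 - f x) &
      @convex_function R 'rV[R]_n [set: 'rV[R]_n]
        (fun x => f x - mu / 2 * enorm x ^+ 2)].

Definition minimizers f : set 'rV[R]_n := [set x | forall y, f x <= f y].

(* [inf] is the real-valued infimum, so [fstar f] is meaningful only when f is
   bounded below, and [dist S x] only when S is nonempty. *)
Definition fstar f : R := inf (range f).

Definition dist S x : R := inf [set enorm (y - x) | y in S].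

Definition proj S x : set 'rV[R]_n := [set y | S y /\ enorm (y - x) = dist S x].

Definition quadratic_gradient_growth f X (mu_g : R) : Prop :=
  0 < mu_g /\
  forall x, X x -> exists xs, proj (minimizers f) x xs /\
    mu_g * dist (minimizers f) x ^+ 2 <= dot (gradient f x) (x - xs).

Definition polyak_lojasiewicz f X (mu_p : R) : Prop :=
  0 < mu_p /\
  forall x, X x -> f x - fstar f <= (2 * mu_p)^-1 * enorm (gradient f x) ^+ 2.

End definitions.

(* Main.v *)
(* For a nearest minimizer z of x and w = z - x, the point x + t^-1 w lies
   beyond z on the line from x, so convexity of L/2 |.|^2 - f at z, together
   with the minimality of f z, gives t (f x - f z) <= L/2 |w|^2 for all
   0 < t < 1; hence f x - f z <= L/2 |w|^2. Expanding
   0 <= |grad f x + mu_g w|^2 and using gradient growth gives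
   mu_g^2 |w|^2 <= |grad f x|^2. *)
From mathcomp Require Import interval_inference ring lra.
Require Import Defs.
Import Order.TTheory GRing.Theory Num.Theory.
Set Implicit Arguments.
Unset Strict Implicit.
Unset Printing Implicit Defensive.
Local Open Scope classical_set_scope.
Local Open Scope ring_scope.

Section euclidean.
Context {R : realType} {n : nat}.
Implicit Types (u v : 'rV[R]_n) (a : R).

Lemma dot_self_ge0 u : 0 <= dot u u.
Proof. by apply: sumr_ge0 => i _; rewrite -expr2 sqr_ge0. Qed.

Lemma sqr_enorm u : enorm u ^+ 2 = dot u u.
Proof. by rewrite sqr_sqrtr ?dot_self_ge0. Qed.

Lemma dotNr u v : dot u (- v) = - dot u v.
Proof. by rewrite /dot -sumrN; apply: eq_bigr => i _; rewrite mxE mulrN. Qed.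

Lemma dot_self_addZ u v a :
  dot (u + a *: v) (u + a *: v) = dot u u + 2 * a * dot u v + a ^+ 2 * dot v v.
Proof.
rewrite /dot !mulr_sumr -!big_split; apply: eq_bigr => i _ /=.
by rewrite !mxE; ring.
Qed.

End euclidean.

Lemma fstar_minimizer (R : realType) (n : nat) (f : 'rV[R]_n -> R) z :
  minimizers f z -> fstar f = f z.
Proof.
move=> zmin; apply/eqP; rewrite eq_le; apply/andP; split.
  by apply: ge_inf; [exists (f z) => _ [y _ <-]; apply: zmin | exists z].
by apply: lb_le_inf; [exists (f z), z | move=> _ [y _ <-]; apply: zmin].
Qed.

Lemma minimizer_quadratic_upper_bound (R : realType) (n : nat) (L : R)
    (f : 'rV[R]_n -> R) (x z : 'rV[R]_n) :
  0 < L ->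
  @convex_function R 'rV[R]_n [set: 'rV[R]_n]
    (fun x => L / 2 * enorm x ^+ 2 - f x) ->
  minimizers f z -> f x - f z <= L / 2 * enorm (z - x) ^+ 2.
Proof.
move=> L_gt0 cvx zmin; set w := z - x; rewrite sqr_enorm.
have bound t : 0 < t -> t < 1 -> t * (f x - f z) <= L / 2 * dot w w.
  move=> t_gt0 t_lt1; have t_neq0 : t != 0 by rewrite gt_eqF.
  pose y := x + t^-1 *: w.
  have := cvx (Itv01 (ltW t_gt0) (ltW t_lt1)) y x (in_setT _) (in_setT _).
  rewrite convRE /= /unstable.onem.
  (* The combination collapses to [z]; it is written [x + 1 *: w] so that [dot_self_addZ] expands
     its square in the same three products as that of [y]. *)
  have -> : (conv (Itv01 (ltW t_gt0) (ltW t_lt1)) (y : convex_lmodType 'rV[R]_n) x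
      : 'rV[R]_n) = x + 1 *: w.
    change (t *: y + (1 - t) *: x = x + 1 *: w).
    rewrite scalerDr scalerA mulfV// !scale1r scalerBl scale1r.
    by rewrite addrAC [t *: x + _]addrC subrK.
  rewrite !sqr_enorm !dot_self_addZ scale1r [x + w]addrC subrK.
  have fzy := zmin y.
  move: (dot x x) (dot x w) (dot w w) => p q r.
  (* Clearing the inverses shows that the [p] and [q] terms agree on both sides of the convexity
     inequality, so only [r] survives, with coefficient [L / 2 * (t^-1 - 1)]. *)
  have -> : t * (L / 2 * (p + 2 * t^-1 * q + t^-1 ^+ 2 * r) - f y)
      = L / 2 * (t * p + 2 * q + t^-1 * r) - t * f y by field.
  move=> h.
  have {}h : (1 - t) * (f x - f z) <= (1 - t) * (L / 2 * r * t^-1).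
    have : t * f z <= t * f y by rewrite ler_pM2l.
    have -> : (1 - t) * (L / 2 * r * t^-1) = L / 2 * (t^-1 * r) - L / 2 * r.
      by field.
    by lra.
  move: h; rewrite ler_pM2l ?subr_gt0// ler_pdivlMr//.
  by rewrite [t * _]mulrC.
have B_ge0 : 0 <= L / 2 * dot w w.
  by rewrite mulr_ge0 ?dot_self_ge0// divr_ge0// ltW.
(* The limit t -> 1 is replaced by one value: if [B < a], then [t = (a + B) / (2 * a)] lies in (0,
   1), and [t * a] is the midpoint of [a] and [B], which exceeds [B]. *)
rewrite leNgt; apply/negP; move: bound B_ge0.
move: (f x - f z) (L / 2 * dot w w) => a B bound B_ge0 ltBa.
have a_gt0 : 0 < a by lra.
have := bound ((a + B) / 2 / a).
rewrite divfK ?gt_eqF// ltr_pdivrMr// mul1r divr_gt0//; last by lra.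
by move=> /(_ isT); lra.
Qed.

Theorem proposition2 (R : realType) (n : nat) (mu L : R)
    (L_gt0 : 0 < L) (mu_ltL : mu < L)
    (f : 'rV[R]_n -> R) (f_class : curvature_class mu L f)
    (f_min : minimizers f !=set0)
    (X : set 'rV[R]_n) (mu_g : R)
    (f_growth : quadratic_gradient_growth f X mu_g) :
  polyak_lojasiewicz f X (mu_g ^+ 2 / L).
Proof.
case: f_growth => mu_g_gt0 growth; case: f_class => _ cvx _.
split=> [|x /growth[z [[zmin <-]]]]; first by rewrite divr_gt0 ?exprn_gt0.
rewrite (fstar_minimizer zmin) -[x - z]opprB dotNr.
have := minimizer_quadratic_upper_bound x L_gt0 cvx zmin.
rewrite !sqr_enorm.
have := dot_self_ge0 (gradient f x + mu_g *: (z - x)); rewrite dot_self_addZ.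
(* Here [r] is the squared distance from [x] to [z], [g] the squared gradient norm, and [c] the
   product of the gradient with [z - x]. *)
move: (dot _ _) (dot _ _) (dot _ _) => r c g g_ge0 upper grow.
have le_rg : mu_g ^+ 2 * r <= g.
  (* Growth scaled by [mu_g] bounds the cross term: [- 2 * mu_g * c] is at least
     [2 * mu_g ^+ 2 * r], and the square gives back one [mu_g ^+ 2 * r]. *)
  have : mu_g * (mu_g * r) <= mu_g * - c by rewrite ler_pM2l.
  by rewrite mulrA -expr2; lra.
apply: (le_trans upper).
have -> : (2 * (mu_g ^+ 2 / L))^-1 * g = L / 2 * (g / mu_g ^+ 2).
  by field; rewrite !gt_eqF.
by rewrite ler_pM2l ?divr_gt0// ler_pdivlMr ?exprn_gt0// mulrC.
Qed.
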